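(* Let $a,b\in\mathbb{N}$ with $\gcd(a,b)=1$. Then $$S_1(a,b)=\frac{1}{12}(a-1)(b-1)(2ab-a-b-1).$$
   Context: $\mathbb{N}$ denotes the positive integers. For relatively prime positive integers $a,b$, let $\mathrm{NR}(a,b)=\{n\in\mathbb{N}: n\ne ax+by \text{ for any } x,y\in\mathbb{Z}_{\ge 0}\}$ be the (finite) set of nonrepresentable numbers, and let $S_1(a,b)=\sum_{n\in\mathrm{NR}(a,b)} n$. *)

(* Defs.v *)
From mathcomp Require Import all_boot all_order all_algebra.
From mathcomp Require Import classical_sets cardinality fsbigop.

Set Implicit Arguments.
Unset Strict Implicit.
Unset Printing Implicit Defensive.

Local Open Scope nat_scope.
Local Open Scope classical_set_scope.

Definition NR (a b : nat) : set nat :=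
  [set n | 0 < n /\ forall x y : nat, n <> a * x + b * y].

(* Sums [\big[_/_]_(_ \in _)] over a set are 0 by convention when infinitely
   many terms are nonzero; this shows that the convention is never used for
   positive coprime [a] and [b]. *)
Lemma finite_NR (a b : nat) :
  0 < a -> 0 < b -> coprime a b -> finite_set (NR a b).
Proof.
move=> a_gt0 b_gt0 co_ab; apply: (sub_finite_set _ (finite_II (a * b))).
move=> n /= [_ nrep]; rewrite ltnNge; apply/negP => le_ab_n.
pose m := chinese a b 0 n %% (a * b).
have m_lt : m < a * b by rewrite ltn_pmod // muln_gt0 a_gt0.
have /dvdnP[x m_x] : a %| m.
  by rewrite /dvdn modn_dvdm ?dvdn_mulr // chinese_modl // mod0n.
have /dvdnP[y nm_y] : b %| n - m.
  rewrite -eqn_mod_dvd ?(ltnW (leq_trans m_lt le_ab_n)) //.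
  by rewrite modn_dvdm ?dvdn_mull // chinese_modr.
apply: (nrep x y).
by rewrite mulnC -m_x mulnC -nm_y subnKC // (ltnW (leq_trans m_lt le_ab_n)).
Qed.

Definition S1 (a b : nat) : nat := \big[addn/0]_(n \in NR a b) n.

(* Main.v *)
Require Import Defs.
From mathcomp Require Import all_boot all_order all_algebra.
From mathcomp Require Import classical_sets cardinality fsbigop.
From mathcomp Require Import ring zify.

Import GRing.Theory.

(** The multiples [b * j], [0 <= j < a], represent all residues modulo [a], and
    [b * j] is the least representable number in its class.  So the
    nonrepresentable numbers are the [b * j %% a + a * k] with
    [k < b * j %/ a], an arithmetic progression for each [j]; as
    [j |-> b * j %% a] permutes the residues, the sum over [j] involves only
    the sums of the [j] and of the [j ^ 2]. *)

Section CoprimeResidues.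
Variables (a b : nat).
Hypotheses (a_gt0 : (0 < a)%N) (co_ab : coprime a b).

Definition residue_mul (j : 'I_a) : 'I_a :=
  Ordinal (ltn_pmod (b * j) a_gt0).

Lemma eqn_modMl_coprime (m n : nat) :
  (b * m == b * n %[mod a]) = (m == n %[mod a]).
Proof.
(* By symmetry the difference [m - n] may be taken untruncated, so that divisibility by [a]
   expresses the congruence. *)
wlog le_nm : m n / (n <= m)%N.
  by move=> IH; case/orP: (leq_total n m) => /IH //; rewrite eq_sym => ->.
by rewrite !eqn_mod_dvd ?leq_mul2l ?le_nm ?orbT // -mulnBr Gauss_dvdr.
Qed.

Lemma residue_mul_inj : injective residue_mul.
Proof.
move=> i j /(congr1 val)/eqP /=.
by rewrite eqn_modMl_coprime !modn_small // => /eqP/val_inj.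
Qed.

Definition gaps : seq nat :=
  [seq (b * j %% a + a * k)%N | j : 'I_a <- enum 'I_a,
                                k <- iota 0 (b * j %/ a)].

(** Reduction modulo [a] recovers [j], as [residue_mul] is injective; then [k] is determined because
    [a] is positive. *)
Lemma gaps_uniq : uniq gaps.
Proof.
apply: allpairs_uniq_dep => [|j _|]; rewrite ?enum_uniq ?iota_uniq //.
move=> [i k] [j l] _ _ /= eq_ik_jl.
have eq_ij : i = j.
  apply: residue_mul_inj; apply: val_inj => /=.
  move/(congr1 (modn^~ a)): eq_ik_jl.
  by rewrite /= !(addnC (_ %% _)) ![(a * _)%N]mulnC !modnMDl !modn_mod.
subst j; congr Tagged; apply/eqP.
by move/eqP: eq_ik_jl; rewrite eqn_add2l eqn_mul2l eqn0Ngt a_gt0.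
Qed.

Lemma mem_gaps (n : nat) :
  reflect (exists2 j : 'I_a, b * j = n %[mod a] & (n < b * j)%N)
          (n \in gaps).
Proof.
apply: (iffP allpairsPdep) => [[j [k [_]]]|[j eq_jn lt_nj]].
  rewrite mem_iota /= add0n => lt_k ->; exists j.
    by rewrite addnC [(a * k)%N]mulnC modnMDl modn_mod.
  rewrite {2}(divn_eq (b * j) a) addnC ltn_add2r mulnC ltn_mul2r.
  by rewrite a_gt0.
exists j, (n %/ a); split; rewrite ?mem_enum ?mem_iota //=; last first.
  by rewrite eq_jn addnC mulnC -divn_eq.
rewrite add0n; move: lt_nj; rewrite {1}(divn_eq n a) {1}(divn_eq (b * j) a).
by rewrite eq_jn ltn_add2r ltn_mul2r a_gt0.
Qed.

(** For [n] congruent to [b * j], if [b * j <= n] then the difference is a multiple of [a] and [n]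
    is representable. Conversely, [n = a * x + b * y] forces [j = y %% a <= y], hence
    [b * j <= n]. *)
Lemma NR_gaps : NR a b = [set` gaps]%classic.
Proof.
apply/seteqP; split => n /=.
  move=> [_ nrep]; apply/mem_gaps.
  have /codomP[j eq_jn] :=
    injF_onto residue_mul_inj (Ordinal (ltn_pmod n a_gt0)).
  have {}eq_jn : b * j = n %[mod a] by move/(congr1 val): eq_jn.
  exists j => //; rewrite ltnNge; apply/negP => le_jn.
  move/eqP: eq_jn; rewrite eq_sym eqn_mod_dvd // => /dvdnP[x eq_x].
  by apply: (nrep x j); rewrite mulnC -eq_x subnK.
move=> /mem_gaps[j eq_jn lt_nj].
suff nrep x y : n <> (a * x + b * y)%N.
  (* Zero is representable with [x = y = 0], which gives positivity. *)
  by split=> //; rewrite lt0n; apply/eqP => n0; apply: (nrep 0 0); lia.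
move=> eq_n; move: lt_nj; rewrite ltnNge => /negP; apply.
move/eqP: eq_jn; rewrite eq_n mulnC [(a * x)%N]mulnC modnMDl mulnC.
rewrite eqn_modMl_coprime modn_small // => /eqP ->.
by rewrite (leq_trans _ (leq_addl _ _)) // leq_mul2l leq_mod orbT.
Qed.

Lemma S1_gaps :
  S1 a b = (\sum_(j < a) \sum_(k < b * j %/ a) (b * j %% a + a * k))%N.
Proof.
rewrite /S1 NR_gaps -fsbig_seq ?gaps_uniq // big_allpairs_dep big_enum /=.
by apply: eq_bigr => j _; rewrite -{1}[(b * j %/ a)%N]subn0 big_mkord.
Qed.

End CoprimeResidues.

Local Open Scope ring_scope.

Section PowerSums.
Variable R : comNzRingType.

(** When [q] and [r] are the quotient and remainder of [b * j] by [a], [q * a + r] is [b * j], so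
    the right side no longer involves the quotient. The factor [2 * a] avoids division in [R]. *)
Lemma sum_arith_progression (a r q : nat) :
  2 * a%:R * (\sum_(k < q) (r + a * k))%:R =
    (q * a + r)%:R ^+ 2 - r%:R ^+ 2 - a%:R * ((q * a + r)%:R - r%:R) :> R.
Proof.
elim: q => [|q IHq]; first by rewrite big_ord0 mul0n add0n; ring.
by rewrite big_ord_recr /= natrD mulrDr IHq; ring.
Qed.

Lemma sum_nat_ring (n : nat) :
  2 * \sum_(j < n) j%:R = n%:R * (n%:R - 1) :> R.
Proof.
elim: n => [|n IHn]; first by rewrite big_ord0; ring.
by rewrite big_ord_recr /= mulrDr IHn; ring.
Qed.

Lemma sum_nat_square (n : nat) :
  6 * \sum_(j < n) j%:R ^+ 2 = n%:R * (n%:R - 1) * (2 * n%:R - 1) :> R.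
Proof.
elim: n => [|n IHn]; first by rewrite big_ord0; ring.
by rewrite big_ord_recr /= mulrDr IHn; ring.
Qed.

End PowerSums.

(** The remainders [b * j %% a] are a permutation of the [j], so subtracting their squares from
    those of [b * j] leaves the factor [b ^ 2 - 1], and the linear terms leave [b - 1]. *)
Lemma S1_power_sums (R : comNzRingType) (a b : nat) :
  (0 < a)%N -> coprime a b ->
  2 * a%:R * (S1 a b)%:R =
    (b%:R ^+ 2 - 1) * \sum_(j < a) j%:R ^+ 2
    - a%:R * (b%:R - 1) * \sum_(j < a) j%:R :> R.
Proof.
move=> a_gt0 co_ab; rewrite S1_gaps // natr_sum mulr_sumr.
have sum_residue (f : nat -> R) :
    \sum_(j < a) f (b * j %% a)%N = \sum_(j < a) f j.
  by rewrite [RHS](reindex_inj (residue_mul_inj _ _ a_gt0 co_ab)).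
under eq_bigr => j _ do rewrite sum_arith_progression -divn_eq natrM exprMn.
rewrite !(sumrB, =^~ mulr_sumr) (sum_residue (fun n => n%:R ^+ 2)).
by rewrite (sum_residue (fun n => n%:R)); ring.
Qed.

Theorem corollary16 (a b : nat) (a_gt0 : (0 < a)%N) (b_gt0 : (0 < b)%N)
    (gcd_ab : gcdn a b = 1%N) :
  (S1 a b)%:R =
    1 / 12 * (a%:R - 1) * (b%:R - 1) * (2 * a%:R * b%:R - a%:R - b%:R - 1)
    :> rat.
Proof.
have a_neq0 : a%:R != 0 :> rat by rewrite Num.Theory.pnatr_eq0 -lt0n.
have eqS := S1_power_sums rat a b a_gt0 (introT eqP gcd_ab).
have eq1 := sum_nat_ring rat a; have eq2 := sum_nat_square rat a.
(* The [12] clears the denominator; [12 * a] splits into the [2 * a] of [S1_power_sums] and the [6]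
   of [sum_nat_square]. *)
apply: (mulfI (_ : 12 * a%:R != 0)); first by rewrite mulf_neq0.
rewrite (_ : 12 * a%:R * _ = 6 * (2 * a%:R * (S1 a b)%:R)); last by ring.
rewrite eqS mulrBr mulrCA eq2.
rewrite (_ : 6 * _ = 3 * a%:R * (b%:R - 1) * (2 * \sum_(j < a) j%:R)).
  by rewrite eq1; field.
by ring.
Qed.
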